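(* Let $X$ be a sieve-complete space, $Y$ a $\mu$-space, and let $F\colon\mathcal{K}(X)\to\mathcal{K}(Y)$ be a monotone set tri-quotient map. Then $Y$ is sieve-complete and $l(Y)\leq l(X)$.
   Context: All spaces are completely regular. $\mathcal{K}(X)$ is the set of all compact subsets of $X$; $\mathcal{T}(X)$ is the topology of $X$. For $\mathcal{S}(X)\subset 2^X$, a map $F\colon\mathcal{S}(X)\to 2^Y$ is monotone if $K\subset L$ implies $F(K)\subset F(L)$. It is set tri-quotient if there is a map $s\colon\mathcal{T}(X)\to\mathcal{T}(Y)$ such that: (str1) $s(U)\subset\bigcup\{F(K):K\in\mathcal{S}(X),\ K\subset U\}$; (str2) $s(X)=Y$; (str3) $U\subset V$ implies $s(U)\subset s(V)$; (str4) if $y\in s(U)$ and $\mathcal{W}$ is a cover of $\bigcup\{K\in F^{-1}(y):K\subset U\}$ by open subsets of $X$, then $y\in s(\bigcup\mathcal{E})$ for some finite $\mathcal{E}\subset\mathcal{W}$; here $F^{-1}(y)=\{K\in\mathcal{S}(X):y\in F(K)\}$. A space is a $\mu$-space if every closed bounded subset is compact, where $A\subset X$ is bounded if every continuous real-valued function on $X$ is bounded on $A$. A sieve on $X$ is a sequence of open covers $\{U_\alpha:\alpha\in A_n\}_{n\in\mathbb{N}}$ of $X$ with maps $\pi_n\colon A_{n+1}\to A_n$ such that $U_\alpha=\bigcup\{U_\beta:\beta\in\pi_n^{-1}(\alpha)\}$ for all $n$ and $\alpha\in A_n$; a $\pi$-chain is a sequence $(\alpha_n)$ with $\alpha_n\in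 A_n$ and $\pi_n(\alpha_{n+1})=\alpha_n$. The sieve is complete if for every $\pi$-chain $(\alpha_n)$, every filter base on $X$ which meshes with $\{U_{\alpha_n}\}$ (every member meets every $U_{\alpha_n}$) has a cluster point in $X$. A space with a complete sieve is sieve-complete. $l(X)$ denotes the Lindelöf number of $X$. *)

(* Defs.v *)
From HB Require Import structures.
From mathcomp Require Import all_boot all_order all_algebra.
From mathcomp Require Import all_classical all_reals all_analysis.
Set Implicit Arguments. Unset Strict Implicit. Unset Printing Implicit Defensive.
Import Order.TTheory GRing.Theory Num.Theory numFieldNormedType.Exports.
Local Open Scope classical_set_scope.
Local Open Scope ring_scope.
Local Open Scope card_scope.

(* Standing assumption: completely regular = Tychonoff (T1 + completely regular),
   complete regularity measured with real-valued functions into R. *)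
Definition tychonoff_space (T : topologicalType) : Prop :=
  completely_regular_space T /\ accessible_space T.

Definition bounded_subset (R : realType) (T : topologicalType) (A : set T) : Prop :=
  forall f : T -> R, continuous f -> exists M : R, forall x, A x -> `|f x| <= M.

Definition mu_space (R : realType) (T : topologicalType) : Prop :=
  forall A : set T, closed A -> bounded_subset R A -> compact A.

Definition filter_base (T : Type) (B : set (set T)) : Prop :=
  B !=set0 /\ (forall b, B b -> b !=set0) /\
  (forall b1 b2, B b1 -> B b2 -> exists2 b3, B b3 & b3 `<=` b1 `&` b2).

Definition cluster_point (T : topologicalType) (B : set (set T)) (x : T) : Prop :=
  forall b, B b -> closure b x.

Record sieve (T : topologicalType) := Sieve {
  sv_idx : nat -> Type;
  sv_U : forall n, sv_idx n -> set T;
  sv_pi : forall n, sv_idx n.+1 -> sv_idx n;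
  sv_open : forall n (a : sv_idx n), open (sv_U a);
  sv_cover : forall n, \bigcup_(a in [set: sv_idx n]) sv_U a = [set: T];
  sv_refine : forall n (a : sv_idx n),
      sv_U a = \bigcup_(b in [set b | sv_pi b = a]) sv_U b
}.

Definition pi_chain (T : topologicalType) (S : sieve T)
    (alpha : forall n, sv_idx S n) : Prop :=
  forall n, sv_pi (alpha n.+1) = alpha n.

Definition complete_sieve (T : topologicalType) (S : sieve T) : Prop :=
  forall alpha : forall n, sv_idx S n, pi_chain alpha ->
  forall B : set (set T), filter_base B ->
    (forall b n, B b -> b `&` sv_U (alpha n) !=set0) ->
    exists x, cluster_point B x.

Definition sieve_complete (T : topologicalType) : Prop :=
  exists S : sieve T, complete_sieve S.

(* l(T) <= kappa, for an infinite cardinal kappa represented by a type K: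
   every open cover has a subcover of cardinality <= |K|. *)
Definition lindelof_le (T : topologicalType) (K : Type) : Prop :=
  forall U : set (set T), (forall u, U u -> open u) -> \bigcup_(u in U) u = [set: T] ->
  exists2 V : set (set T), V `<=` U /\ \bigcup_(u in V) u = [set: T] & V #<= [set: K].

(* l(X) <= l(Y) as cardinals (Lindelof number = least infinite such kappa). *)
Definition lindelof_number_le (X Y : topologicalType) : Prop :=
  forall K : Type, infinite_set [set: K] -> lindelof_le Y K -> lindelof_le X K.

(* F : K(X) -> K(Y), represented on all subsets but constrained on compacta. *)
Definition compact_valued (X Y : topologicalType) (F : set X -> set Y) : Prop :=
  forall K, compact K -> compact (F K).

Definition monotone_on_compacta (X Y : topologicalType) (F : set X -> set Y) : Prop :=
  forall K L, compact K -> compact L -> K `<=` L -> F K `<=` F L.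

(* set tri-quotient map with S(X) = K(X). *)
Definition set_tri_quotient (X Y : topologicalType) (F : set X -> set Y) : Prop :=
  exists s : set X -> set Y,
    (forall U, open U -> open (s U)) /\
    (forall U, open U ->
       s U `<=` \bigcup_(K in [set K | compact K /\ K `<=` U]) F K) /\
    s [set: X] = [set: Y] /\
    (forall U V, open U -> open V -> U `<=` V -> s U `<=` s V) /\
    (forall U y, open U -> s U y ->
       forall W : set (set X), (forall w, W w -> open w) ->
       \bigcup_(K in [set K | compact K /\ F K y /\ K `<=` U]) K
         `<=` \bigcup_(w in W) w ->
       exists2 E : set (set X), finite_set E /\ E `<=` W &
         s (\bigcup_(w in E) w) y).

(* Main.v *)
(* From a complete sieve on X one obtains a sieve on Y by taking the sets s(U_E),
   where U_E is the union of finitely many members of the n-th cover of X: (str4)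
   makes these sets refine each other.  Along a chain (E_n), Konig's lemma shows
   that the sequence U_(E_n) is still complete, so compact sets K_n included in
   U_(E_n) have a common compact superset L; by monotonicity every sequence of
   points of the s(U_(E_n)) stays in the compact set F(L).  The intersection D of
   the closures of the s(U_(E_n)) is therefore bounded, hence compact because Y is
   a mu-space, and D absorbs the cluster points of the meshing filter bases.

   If l(X) <= K, the sieve on X can be thinned to K indices per level, and then so
   can the sieve on Y.  By completeness, every chain of the latter has a member
   covered by finitely many sets of a given open cover of Y, so K many of them
   suffice. *)
Require Import Defs.
From mathcomp Require Import all_boot all_order all_algebra finmap.
From mathcomp Require Import all_classical all_reals all_analysis.
Set Implicit Arguments. Unset Strict Implicit. Unset Printing Implicit Defensive.
Import Order.TTheory GRing.Theory Num.Theory numFieldNormedType.Exports.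
Local Open Scope classical_set_scope.
Local Open Scope card_scope.

(** * Cardinal arithmetic *)

(** Zorn's lemma is applied to graphs of partial injections from [A] to [B]: a maximal one missing a
    point on each side could be extended by that pair. *)
Lemma card_le_total (T U : pointedType) (A : set T) (B : set U) :
  A #<= B \/ B #<= A.
Proof.
pose P (G : set (T * U)) := [/\ G `<=` A `*` B,
  (forall x y y', G (x, y) -> G (x, y') -> y = y') &
  (forall x x' y, G (x, y) -> G (x', y) -> x = x')].
have [F FP totF|G [[GAB Gf Gi] Gmax]] := @Zorn_bigcup _ P.
  have pair p q : (\bigcup_(X in F) X) p -> (\bigcup_(X in F) X) q ->
      exists2 X, F X & X p /\ X q.
    move=> [X FX Xp] [Z FZ Zq]; have [XZ|ZX] := totF _ _ FX FZ.
      by exists Z => //; split => //; exact: XZ.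
    by exists X => //; split => //; exact: ZX.
  split.
  - by move=> p [X FX Xp]; have [+ _ _] := FP _ FX; apply.
  - move=> x y y' p q; have [X /FP[_ h _] [Xp Xq]] := pair _ _ p q.
    exact: h Xp Xq.
  - move=> x x' y p q; have [X /FP[_ _ h] [Xp Xq]] := pair _ _ p q.
    exact: h Xp Xq.
have [domA|] := pselect (forall x, A x -> exists y, G (x, y)).
  left; have /choice[f fP] : forall x, exists y, A x -> G (x, y).
    move=> x; have [/domA[y Gxy]|nA] := pselect (A x); first by exists y.
    by exists point.
  apply/pcard_leP/injfunPex; exists f; first by move=> x /fP/GAB[].
  move=> x x' /set_mem/fP Gx /set_mem/fP Gx' E.
  by move: Gx'; rewrite -E => /(Gi _ _ _ Gx).
move=> /existsNP[x0 /not_implyP[Ax0 nx0]].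
have [ranB|] := pselect (forall y, B y -> exists x, G (x, y)).
  right; have /choice[f fP] : forall y, exists x, B y -> G (x, y).
    move=> y; have [/ranB[x Gxy]|nB] := pselect (B y); first by exists x.
    by exists point.
  apply/pcard_leP/injfunPex; exists f; first by move=> y /fP/GAB[].
  move=> y y' /set_mem/fP Gy /set_mem/fP Gy' E.
  by move: Gy'; rewrite -E => /(Gf _ _ _ Gy).
move=> /existsNP[y0 /not_implyP[By0 ny0]].
case: (Gmax ((x0, y0) |` G)).
  split; first by move=> p Gp; right.
  by move=> /(_ (x0, y0) (or_introl erefl)) Gxy; apply: nx0; exists y0.
split.
- by move=> p [->|/GAB].
- move=> x y y' [[-> ->]|Gxy] [|Gxy'] => [[<-]|||].
  + by [].
  + by case: nx0; exists y'.
  + by move=> [xE _]; case: nx0; exists y; rewrite -xE.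
  + exact: Gf Gxy Gxy'.
- move=> x x' y [[-> ->]|Gxy] [|Gxy'] => [[<-]|||].
  + by [].
  + by case: ny0; exists x'.
  + by move=> [_ yE]; case: ny0; exists x; rewrite -yE.
  + exact: Gi Gxy Gxy'.
Qed.

(* A maximal partial pairing [A * A -> A] above a countable one lives on a set [A]
   into which [~` A] injects: otherwise a disjoint copy of [A] can be adjoined.
   Then [K] injects into two copies of [A], hence into [A]. *)
Lemma card_square (K : pointedType) :
  infinite_set [set: K] -> [set: K * K] #<= [set: K].
Proof.
move=> infK.
(* Partial pairings on a subset of [K], coded by their graphs. *)
pose dom (G : set (K * K * K)) := [set x | exists z, G (x, x, z)].
pose pairing (G : set (K * K * K)) := [/\
  (forall x y z, G (x, y, z) -> [/\ dom G x, dom G y & dom G z]),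
  (forall x y, dom G x -> dom G y -> exists z, G (x, y, z)),
  (forall p z z', G (p, z) -> G (p, z') -> z = z') &
  (forall p p' z, G (p, z) -> G (p', z) -> p = p')].
have [g ginj] : exists g : nat -> K, injective g.
  have /pcard_leP/injfunPex[g _ gi] := iffLR (infiniteP _) infK.
  by exists g => x y; apply: gi; rewrite inE.
have [h hinj] : exists h : nat * nat -> nat, injective h.
  have /card_eqPle[/pcard_leP/injfunPex[h _ hi] _] := card_nat2.
  by exists h => x y; apply: hi; rewrite inE.
pose G0 : set (K * K * K) := range (fun p : nat * nat => (g p.1, g p.2, g (h p))).
have dom0 x : dom G0 x -> exists n, x = g n.
  by move=> [z [[i j] _ /= [<- _ _]]]; exists i.
have domg i : dom G0 (g i) by exists (g (h (i, i))), (i, i).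
have pG0 : pairing G0.
  split.
  - by move=> x y z [[i j] _ /= [<- <- <-]]; split; exact: domg.
  - by move=> _ _ /dom0[i ->] /dom0[j ->]; exists (g (h (i, j))), (i, j).
  - move=> p z z' [[i j] _ [<- <-]] [[i' j'] _ [/ginj -> /ginj ->]].
    by move->.
  - move=> p p' z [[i j] _ [<- <-]] [[i' j'] _ [<- /ginj/hinj[-> ->]]].
    by [].
(* Adding [G0] takes care of the empty chain in Zorn's lemma and puts every [g i] into the domain of
   the maximal pairing. *)
pose P G := pairing (G0 `|` G).
have [F FP totF|M [PM Mmax]] := @Zorn_bigcup _ P.
  pose Gt := G0 `|` \bigcup_(X in F) X.
  have pair p q : Gt p -> Gt q ->
      exists X, [/\ pairing X, X `<=` Gt, X p & X q].
    have sub X : F X -> G0 `|` X `<=` Gt.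
      by move=> FX r [?|Xr]; [left|right; exists X].
    move=> [p0|[X FX Xp]] [q0|[Z FZ Zq]].
    - by exists G0; split => // r; left.
    - by exists (G0 `|` Z); split; [exact: FP|exact: sub|left|right].
    - by exists (G0 `|` X); split; [exact: FP|exact: sub|right|left].
    - have [XZ|ZX] := totF _ _ FX FZ.
        by exists (G0 `|` Z); split; [exact: FP|exact: sub|right; exact: XZ|right].
      by exists (G0 `|` X); split; [exact: FP|exact: sub|right|right; exact: ZX].
  have domS X : X `<=` Gt -> dom X `<=` dom Gt.
    by move=> XG x [z /XG Gz]; exists z.
  rewrite /P -/Gt; split.
  - move=> x y z Gp; have [X [[X1 _ _ _] /domS XG Xp _]] := pair _ _ Gp Gp.
    by have [Dx Dy Dz] := X1 _ _ _ Xp; split; exact: XG.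
  - move=> x y [z Gz] [w Gw]; have [X [[X1 X2 _ _] XG Xp Xq]] := pair _ _ Gz Gw.
    have [v Xv] := X2 x y (ex_intro _ _ Xp) (ex_intro _ _ Xq).
    by exists v; exact: XG.
  - move=> p z z' Gp Gq; have [X [[_ _ X3 _] _ Xp Xq]] := pair _ _ Gp Gq.
    exact: X3 Xp Xq.
  - move=> p p' z Gp Gq; have [X [[_ _ _ X4] _ Xp Xq]] := pair _ _ Gp Gq.
    exact: X4 Xp Xq.
set G := G0 `|` M in PM.
have {PM}[G1 G2 G3 G4] : pairing G := PM.
pose A := dom G.
have /choice[f fP] : forall p : K * K, exists z, A p.1 -> A p.2 -> G (p, z).
  move=> [x y]; have [[Ax Ay]|nA] := pselect (A x /\ A y).
    by have [z Gz] := G2 x y Ax Ay; exists z.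
  by exists point => Ax Ay; case: nA.
have fA x y : A x -> A y -> A (f (x, y)).
  by move=> Ax Ay; have [] := G1 _ _ _ (fP (x, y) Ax Ay).
have finj x y x' y' : A x -> A y -> A x' -> A y' ->
    f (x, y) = f (x', y') -> x = x' /\ y = y'.
  move=> Ax Ay Ax' Ay' E; have := fP (x', y') Ax' Ay'; rewrite -E.
  by move=> /(G4 _ _ _ (fP (x, y) Ax Ay))[].
have gA i : A (g i) by have [z Gz] := domg i; exists z; left.
(* Two distinct points of [A], used as tags to tell two copies of [A] apart inside [A]. *)
pose c (b : bool) := g b.
have cA b : A (c b) by exact: gA.
have cinj b b' : c b = c b' -> b = b' by move=> /ginj; case: b b' => [] [].
suff cKA : [set: K] #<= A.
  have /pcard_leP/injfunPex[k kA kinj] := cKA.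
  apply/pcard_leTP/injPex; exists (fun p => f (k p.1, k p.2)).
  move=> [x y] [x' y'] _ _ /= /finj[]; try exact: kA.
  by move=> /kinj kx /kinj ky; rewrite kx ?inE // ky ?inE.
have [/pcard_leP/injfunPex[e eA einj]|/pcard_leP/injfunPex[e eA einj]] :=
  card_le_total A (~` A); last first.
  apply/pcard_leP/injfunPex.
  exists (fun x => if x \in A then f (c true, x) else f (c false, e x)).
    by move=> x _; case: ifPn => [/set_mem Ax|/negP nAx]; apply: fA => //;
      apply: eA => Ax; apply: nAx; exact: mem_set.
  move=> x y _ _; case: ifPn => [/set_mem Ax|/negP nAx];
    case: ifPn => [/set_mem Ay|/negP nAy].
  - by move=> /finj[].
  - move=> /finj[]//; first by apply: eA => Ay; apply: nAy; exact: mem_set.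
    by move=> /cinj.
  - move=> /finj[]//; first by apply: eA => Ax; apply: nAx; exact: mem_set.
    by move=> /cinj.
  - have nAx' : (~` A) x by move=> /mem_set.
    have nAy' : (~` A) y by move=> /mem_set.
    by move=> /finj[]//; [exact: eA|exact: eA|move=> _; apply: einj; rewrite inE].
(* Adjoin to [A] its copy [e @` A]: pairs outside [A * A] are sent into the copy. *)
exfalso.
pose B := e @` A.
have nAB x : A x -> ~ B x by move=> Ax [y /eA nA yx]; apply: nA; rewrite yx.
have /choice[d dP] : forall x, exists y, B x -> A y /\ e y = x.
  move=> x; have [[y Ay yx]|nB] := pselect (B x); first by exists y.
  by exists point.
(* On [A] and its copy, [r x] together with the flag [x \in A] determines [x]. *)
pose r x := if x \in A then x else d x.
pose AB := A `|` B.
have rA x : AB x -> A (r x).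
  rewrite /r; case: ifPn => [/set_mem//|/negP nA] [/mem_set//|Bx].
  by have [] := dP x Bx.
have rinj x y : AB x -> AB y -> (x \in A) = (y \in A) -> r x = r y -> x = y.
  move=> ABx ABy; rewrite /r => E; rewrite E; case: ifPn => // nAy.
  have nAx : x \notin A by rewrite E.
  have Bx : B x by case: ABx => // /mem_set Ax; rewrite Ax in nAx.
  have By : B y by case: ABy => // /mem_set Ay; rewrite Ay in nAy.
  by have [_ {2}<-] := dP x Bx; have [_ {2}<-] := dP y By => ->.
(* [f] packs the two flags and the two representatives into one point of [A]; [e] then moves it into
   the copy, away from the values of [G]. *)
pose f' x y := e (f (f (c (x \in A), c (y \in A)), f (r x, r y))).
have f'B x y : AB x -> AB y -> B (f' x y).
  move=> /rA Ax /rA Ay; exists (f (f (c (x \in A), c (y \in A)), f (r x, r y))) => //.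
  by apply: (fA); exact: fA.
have f'inj x y x' y' : AB x -> AB y -> AB x' -> AB y' ->
    f' x y = f' x' y' -> x = x' /\ y = y'.
  move=> hx hy hx' hy'.
  have [Ax Ay Ax' Ay'] := And4 (rA _ hx) (rA _ hy) (rA _ hx') (rA _ hy').
  move=> /einj; rewrite !inE => /(_ (fA _ _ (fA _ _ (cA _) (cA _)) (fA _ _ Ax Ay))).
  move=> /(_ (fA _ _ (fA _ _ (cA _) (cA _)) (fA _ _ Ax' Ay'))).
  move=> /finj[]; try (by apply: fA).
  move=> /finj[]// /cinj xx' /cinj yy' /finj[]// rx ry.
  by split; exact: rinj.
pose N : set (K * K * K) := [set p | [/\ AB p.1.1, AB p.1.2,
  ~ (A p.1.1 /\ A p.1.2) & p.2 = f' p.1.1 p.1.2]].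
have domN x : dom (G `|` N) x <-> AB x.
  split=> [[z [Gz|[]//]]|[Ax|Bx]].
  - by left; exists z.
  - by have [z Gz] := G2 x x Ax Ax; exists z; left.
  - by exists (f' x x); right; split; [right|right|case=> /nAB|].
apply: (Mmax (M `|` N)).
  split; first by move=> p; left.
  move=> NM; have eg : B (e (g 0%N)) by exists (g 0%N).
  have : N (e (g 0%N), e (g 0%N), f' (e (g 0%N)) (e (g 0%N))).
    by split; [right|right|case=> /nAB|].
  move=> Ne; have Me := NM _ (or_intror Ne).
  by apply: (nAB (e (g 0%N)) _ eg); exists (f' (e (g 0%N)) (e (g 0%N))); right.
rewrite /P setUA -/G; split.
- move=> x y z [/G1[Ax Ay Az]|[/= ABx ABy _ ->]]; split; apply/domN.
  + by left.
  + by left.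
  + by left.
  + by [].
  + by [].
  + by right; exact: f'B.
- move=> x y /domN ABx /domN ABy; have [[Ax Ay]|nA] := pselect (A x /\ A y).
    by have [z Gz] := G2 x y Ax Ay; exists z; left.
  by exists (f' x y); right.
- move=> [x y] z z' [Gz|[/= ABx ABy nA ->]] [Gz'|[/= ABx' ABy' nA' ->]] //.
  + exact: G3 Gz Gz'.
  + by case: nA'; have [] := G1 _ _ _ Gz.
  + by case: nA; have [] := G1 _ _ _ Gz'.
- move=> [x y] [x' y'] z [Gz|[/= ABx ABy nA ->]] [Gz'|[/= ABx' ABy' nA' E]] //.
  + exact: G4 Gz Gz'.
  + have [_ _ Az] := G1 _ _ _ Gz; case: (nAB _ Az); rewrite E.
    exact: f'B.
  + have [_ _ Az] := G1 _ _ _ Gz'; case: (nAB _ Az).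
    exact: f'B.
  + by have [-> ->] := f'inj _ _ _ _ ABx ABy ABx' ABy' E.
Qed.

Section InfiniteCardinal.
Variable K : pointedType.
Hypothesis infK : infinite_set [set: K].

(** Injections of [A] and of each fibre [F x] into [K] combine into one into [K * K], which
    [card_square] brings back to [K]. *)
Lemma card_setX_le (T U : Type) (A : set T) (F : T -> set U) :
  A #<= [set: K] -> (forall x, A x -> F x #<= [set: K]) ->
  [set p | A p.1 /\ F p.1 p.2] #<= [set: K].
Proof.
move=> /pcard_leTP/injPex[a ainj] FK.
have /pcard_leTP/injPex[s sinj] := card_square infK.
have /choice[f finj] : forall x, exists f : U -> K, A x -> set_inj (F x) f.
  move=> x; have [/FK/pcard_leTP/injPex[f fi]|nA] := pselect (A x); first by exists f.
  by exists (fun=> point).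
apply/pcard_leTP/injPex; exists (fun p => s (a p.1, f p.1 p.2)).
move=> [x y] [x' y'] /set_mem[/= Ax Fy] /set_mem[/= Ax' Fy'] /sinj.
rewrite !inE => /(_ I I)[/ainj]; rewrite !inE => /(_ Ax Ax') xx'.
by rewrite -xx' in Fy' *; move=> /(finj _ Ax) ->; rewrite ?inE.
Qed.

Lemma card_bigcup_le (T U : Type) (A : set T) (F : T -> set U) :
  A #<= [set: K] -> (forall x, A x -> F x #<= [set: K]) ->
  \bigcup_(x in A) F x #<= [set: K].
Proof.
move=> AK FK; apply: card_le_trans (card_setX_le AK FK).
apply: card_le_trans (card_image_le snd _).
by apply: subset_card_le => y [x Ax Fy]; exists (x, y).
Qed.

(** Induction on the size: a subset with [n.+1] elements is a point of [A] added to one with [n]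
    elements. The sizes are only countably many. *)
Lemma card_finite_subsets (T : Type) (A : set T) :
  A #<= [set: K] -> [set B | B `<=` A /\ finite_set B] #<= [set: K].
Proof.
move=> AK; suff nK n : [set B | B `<=` A /\ B #= `I_n] #<= [set: K].
  suff -> : [set B | B `<=` A /\ finite_set B] =
      \bigcup_n [set B | B `<=` A /\ B #= `I_n].
    by apply: card_bigcup_le => // ; exact: (iffLR (infiniteP _) infK).
  rewrite eqEsubset; split=> [B [BA [n Bn]]|B [n _ [BA Bn]]]; first by exists n.
  by split => //; exists n.
elim: n => [|n IH].
  have -> : [set B : set T | B `<=` A /\ B #= `I_0] = [set set0].
    rewrite eqEsubset II0; split=> [B [_]|_ ->] /=; last by split.
    by rewrite card_eq0 => /eqP.
  by apply/pcard_leTP/injPex; exists (fun=> point) => _ _ /set_mem -> /set_mem ->.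
have := card_setX_le AK (fun x _ => IH).
apply: card_le_trans.
apply: card_le_trans (card_image_le (fun u => u.1 |` u.2) _).
apply: subset_card_le => B [BA] /eq_cardSP [x Bx BDx].
exists (x, B `\ x) => /=; last by apply: setDUK => ? ->.
by do !split=> //; [exact: BA | apply: subset_trans _ BA; apply: subDsetl].
Qed.

End InfiniteCardinal.

(** * Compactness and complete sequences *)

Lemma nonincr_subset (T : Type) (V : nat -> set T) :
  (forall n, V n.+1 `<=` V n) ->
  forall m n, (m <= n)%N -> V n `<=` V m.
Proof.
move=> decV m n /subnK <-; elim: (n - m)%N => [|k IH] //=.
by rewrite addSn; apply: subset_trans IH; exact: decV.
Qed.

Lemma proper_filter_meet (T : Type) (G : set_system T) (A B : set T) :
  ProperFilter G -> G A -> G B -> A `&` B !=set0.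
Proof. by move=> GP GA GB; apply: (@filter_ex _ G); exact: filterI. Qed.

(** The limit may lie outside [A]; in a regular space this amounts to relative compactness. *)
Definition ultra_convergent (T : topologicalType) (A : set T) :=
  forall G : set_system T, UltraFilter G -> G A -> exists x : T, G --> x.

(** The traces on [A] of the open members of [G] generate a proper filter, and an ultrafilter [H]
    finer than it converges to some [x]. By regularity [G] converges to [x] too: the complement of a
    closed neighbourhood of [x] is open, so if it were in [G] it would be in [H]. *)
Lemma compact_closure_ultra (T : topologicalType) (A : set T) :
  regular_space T -> ultra_convergent A -> compact (closure A).
Proof.
move=> regT convA; rewrite compact_ultra => G GU GclA.
have PF : ProperFilter
    (filter_from [set O | open O /\ G O] (fun O => O `&` A)).
  apply: filter_from_proper.
    apply: filter_from_filter; first by exists setT; split; [exact: openT|exact: filterT].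
    move=> O1 O2 [e1 G1] [e2 G2]; exists (O1 `&` O2).
      by split; [exact: openI|exact: filterI].
    by move=> x [[? ?] ?].
  move=> O [eO GO]; have [x [yO clAx]] := proper_filter_meet _ GO GclA.
  have [y [Ay Oy]] := clAx O (open_nbhs_nbhs (conj eO yO)).
  by exists y.
have [H [HU FH]] := ultraFilterLemma PF.
have HO O : open O -> G O -> H O.
  by move=> eO GO; apply: FH; exists O => // x [].
have HA : H A.
  by apply: FH; exists setT => [|x []//]; split; [exact: openT|exact: filterT].
have [x Hx] := convA H HU HA.
exists x; split.
  move=> N Nx; have [y [Ay Ny]] := proper_filter_meet _ HA (Hx _ Nx).
  by exists y.
move=> N /(regT x)[M Mx clMN].
have [GM|GnM] := in_ultra_setVsetC (closure M) GU; first exact: filterS GM.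
have HnM : H (~` closure M) by apply: HO => //; exact/closed_openC/closed_closure.
have [y [My nMy]] := proper_filter_meet _ (Hx _ Mx) HnM.
by case: nMy; exact: subset_closure.
Qed.

(** Ultrafilter form of what a complete sieve asks of a chain: for an ultrafilter, meshing with a
    set is containing it, and clustering is converging. *)
Definition complete_sequence (T : topologicalType) (U : nat -> set T) :=
  forall G : set_system T, UltraFilter G -> (forall n, G (U n)) ->
    exists x : T, G --> x.

(** An ultrafilter containing the union of the [K n] either contains one of them, which is compact,
    or contains every tail of the union. The tail from [n] on lies in [U n], so completeness
    applies. *)
Lemma common_compact (T : topologicalType) (U : nat -> set T) (K : nat -> set T) :
  regular_space T -> (forall n, U n.+1 `<=` U n) -> complete_sequence U ->
  (forall n, compact (K n)) -> (forall n, K n `<=` U n) ->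
  exists2 L, compact L & forall n, K n `<=` L.
Proof.
move=> regT decU cU cK KU; exists (closure (\bigcup_n K n)); last first.
  by move=> n x Kx; apply: subset_closure; exists n.
apply: compact_closure_ultra => // G GU GK.
have [[n GKn]|noK] := pselect (exists n, G (K n)).
  have := cK n; rewrite compact_ultra => /(_ G GU GKn)[x [_ Gx]].
  by exists x.
apply: (cU) => n.
have {}noK m : G (~` K m).
  by have [Gm|//] := in_ultra_setVsetC (K m) GU; case: noK; exists m.
suff : G (\bigcup_(m in [set m | (n <= m)%N]) K m).
  apply: filterS => x [m /= nm Kx].
  exact: (nonincr_subset decU nm (KU m x Kx)).
elim: n => [|n IH].
  by apply: filterS GK => x [m _ Kx]; exists m.
apply: filterS (filterI IH (noK n)) => x [[m /= nm Kx] nKx]; exists m => //=.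
by rewrite ltn_neqAle nm andbT; apply/eqP => nE; apply: nKx; rewrite nE.
Qed.

(** * Decreasing sequences of sets in a mu-space *)

Section MuSpace.
Variables (R : realType) (Y : topologicalType) (V : nat -> set Y).
Hypotheses (muY : mu_space R Y) (decV : forall n, V n.+1 `<=` V n).
Hypothesis seqV : forall y : nat -> Y, (forall n, V n (y n)) ->
  exists2 L, compact L & forall n, L (y n).

Let D := \bigcap_n closure (V n).

(** If [f] were unbounded on [D], the open set where [|f|] exceeds [n] would meet [V n] in some
    [y n]; but [f] is bounded on a compact set containing all the [y n]. *)
Lemma compact_bigcap_closure : compact D.
Proof.
apply: (muY).
  by apply: closed_bigI => n _; exact: closed_closure.
move=> f cf; apply: contrapT => unb.
have /choice[y yP] : forall n : nat, exists y, V n y /\ (n%:R < `|f y|)%R.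
  move=> n; have [d [Dd fd]] : exists d, D d /\ (n%:R < `|f d|)%R.
    apply: contrapT => nd; apply: unb; exists n%:R%R => d Dd.
    by rewrite leNgt; apply/negP => fd; apply: nd; exists d.
  have cnf : continuous (fun x => `|f x|)%R.
    by move=> x; apply: cvg_norm; exact: cf.
  have oO : open ((fun x => `|f x|)%R @^-1` [set r | (n%:R < r)%R]).
    apply: open_comp; last exact: open_gt.
    by move=> x _; exact: cnf.
  have [z [Vz fz]] := Dd n I _ (open_nbhs_nbhs (conj oO fd)).
  by exists z.
have [|L cL Ly] := seqV (y := y); first by move=> n; have [] := yP n.
have := compact_bounded (continuous_compact (continuous_subspaceT cf) cL).
move=> [M [_ /(_ (M + 1)%R)]] /(_ (ltr_pwDr ltr01 (lexx _))) bM.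
(* This index exceeds [M + 1], a bound for [|f|] on [L]. *)
have [_] := yP (Num.bound `|M + 1|%R).
apply/negP; rewrite -leNgt.
have /bM/le_trans : (f @` L) (f (y (Num.bound `|M + 1|%R))).
  by exists (y (Num.bound `|M + 1|%R)).
by apply; apply: le_trans (ler_norm _) _; apply/ltW/archi_boundP; exact: normr_ge0.
Qed.

(** Points chosen in the sets [b]&[V n] cluster at a point of [D] and of [closure b]. Hence the
    traces of the closures on the compact set [D] generate a proper filter, whose cluster point
    serves [B]. *)
Lemma mu_space_cluster (B : set (set Y)) : filter_base B ->
  (forall b n, B b -> b `&` V n !=set0) -> exists x, cluster_point B x.
Proof.
move=> [[b0 Bb0] [_ BI]] meshB.
have meetD b : B b -> D `&` closure b !=set0.
  move=> Bb; have /choice[y yP] : forall n, exists y, (b `&` V n) y.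
    by move=> n; exact: meshB.
  have [|L cL Ly] := seqV (y := y); first by move=> n; have [] := yP n.
  have [z [_ clz]] : L `&` cluster (y @ \oo) !=set0.
    by apply: (cL (y @ \oo)); exists 0%N => // m _; exact: Ly.
  exists z; split.
    move=> n _ N Nz.
    have yV : (y @ \oo) (V n).
      by exists n => // m /= nm; apply: (nonincr_subset decV nm); have [] := yP m.
    exact: clz yV Nz.
  move=> N Nz; apply: clz Nz.
  by exists 0%N => // m _; have [] := yP m.
have PF : ProperFilter (filter_from B (fun b => D `&` closure b)).
  apply: filter_from_proper => //; apply: filter_from_filter; first by exists b0.
  move=> b1 b2 B1 B2; have [b3 B3 b3s] := BI _ _ B1 B2; exists b3 => //.
  move=> x [Dx b3x]; have [] := closureI (closureS b3s b3x).
  by [].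
have [x [Dx clx]] : D `&` cluster (filter_from B (fun b => D `&` closure b)) !=set0.
  by apply: compact_bigcap_closure; exists b0 => // x [].
exists x => b Bb.
suff : closure (closure b) x by rewrite -(iffLR (closure_id _) (@closed_closure _ b)).
by move=> N Nx; apply: clx Nx; exists b.
Qed.

End MuSpace.

(** * Sieves from trees *)

Lemma dependent_choice_chain (N : nat -> Type) (P : forall n, N n -> Prop)
    (ch : forall n, N n -> N n.+1 -> Prop) :
  (exists a, P 0%N a) ->
  (forall n a, P n a -> exists2 b, ch n a b & P n.+1 b) ->
  exists a : forall n, N n, (forall n, P n (a n)) /\ (forall n, ch n (a n) (a n.+1)).
Proof.
move=> /cid[a0 Pa0] step.
pose next n (u : {a : N n | P n a}) :
    {b : {a : N n.+1 | P n.+1 a} | ch n (sval u) (sval b)} :=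
  let v := cid2 (step n (sval u) (svalP u)) in
  exist _ (exist _ (s2val v) (s2valP' v)) (s2valP v).
pose fix u n : {a : N n | P n a} :=
  if n is m.+1 then sval (next m (u m)) else exist _ a0 Pa0.
exists (fun n => sval (u n)); split=> n; first exact: svalP.
exact: (svalP (next n (u n))).
Qed.

(** Otherwise each point of [A] leaves at some stage, and [D] is empty at the largest of these
    finitely many stages. *)
Lemma finite_decreasing_meet (T : Type) (A : set T) (D : nat -> set T) :
  finite_set A -> (forall k, D k `<=` A) -> (forall k, D k.+1 `<=` D k) ->
  (forall k, D k !=set0) -> exists x, forall k, D k x.
Proof.
elim/Peq: T A D => T A D /finite_seqP[X ->] DA decD D0.
apply: contrapT => nD.
have /choice[k kP] : forall x, exists k, ~ D k x.
  by move=> x; apply/existsNP => Dx; apply: nD; exists x.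
have [x Dx] := D0 (\max_(x <- X) k x)%N.
apply: (kP x); apply: (nonincr_subset decD _ Dx).
by apply: leq_bigmax_seq => //; exact: DA Dx.
Qed.

(** Finiteness provides a node at level zero with descendants in all generations, and below each
    such node a child of the same kind. *)
Lemma konig (N : nat -> Type) (pi : forall n, N n.+1 -> N n)
    (T : forall n, set (N n)) :
  (forall n, finite_set (T n)) -> (forall n, T n !=set0) ->
  (forall n, @pi n @` T n.+1 `<=` T n) ->
  exists a : forall n, N n, (forall n, T n (a n)) /\
    (forall n, pi n (a n.+1) = a n).
Proof.
move=> finT T0 piT.
(* [D k n] is the set of members of [T n] having [k] generations of descendants. *)
pose D := fix D k n : set (N n) :=
  if k is k'.+1 then T n `&` @pi n @` D k' n.+1 else T n.
have DT k n : D k n `<=` T n by case: k => [|k] x //= [].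
have decD k : forall n, D k.+1 n `<=` D k n.
  elim: k => [|k IH] n x [Tx [y Dy yx]]; first exact: Tx.
  by split=> //; exists y => //; exact: IH.
have D0 k : forall n, D k n !=set0.
  elim: k => [|k IH] n; first exact: T0.
  have [y Dy] := IH n.+1; exists (pi n y); split; last by exists y.
  by apply: piT; exists y => //; exact: DT Dy.
have [|n a Da|a [Da pia]] := dependent_choice_chain
    (P := fun n a => forall k, D k n a) (ch := fun n a b => pi n b = a).
- by apply: finite_decreasing_meet (finT 0%N) _ _ _ => k //; exact: DT.
- have [||||b Db] := finite_decreasing_meet (A := T n.+1)
      (D := fun k => D k n.+1 `&` [set b | pi n b = a]).
  + exact: finT.
  + by move=> k x [/DT].
  + by move=> k x [/decD].
  + by move=> k; have [_ [b Db <-]] := Da k.+1; exists b.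
  by exists b; [have [] := Db 0%N|move=> k; have [] := Db k].
- by exists a; split => // n; exact: (Da n 0%N).
Qed.

Lemma ultra_finite_bigcup (I T : Type) (G : set_system T) (A : set I)
    (U : I -> set T) :
  UltraFilter G -> finite_set A -> G (\bigcup_(i in A) U i) ->
  exists2 i, A i & G (U i).
Proof.
elim/Pchoice: I A U => I A U GU /finite_fsetP[X ->] GUA.
apply: contrapT => noi.
have GC i : [set` X] i -> G (~` U i).
  by move=> iX; have [Gi|//] := in_ultra_setVsetC (U i) GU; case: noi; exists i.
have [x [[i iX Ux] nUx]] := proper_filter_meet _ GUA (filter_bigI _ GC).
exact: (nUx i iX).
Qed.

(** (str4) returns a finite set of open sets, whereas the tree on [Y] needs a finite set of
    indices. *)
Lemma finite_subset_preimage (I T : Type) (U : I -> T) (A : set I) (E : set T) :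
  finite_set E -> E `<=` U @` A ->
  exists2 B, B `<=` A & finite_set B /\ U @` B = E.
Proof.
move=> finE EUA.
have /choice[g gP] : forall x : E, exists i, A i /\ U i = \val x.
  by move=> x; have [i Ai Ui] := EUA _ (set_valP x); exists i.
exists (range g); first by move=> _ [x _ <-]; have [] := gP x.
split.
  by apply: finite_image; rewrite (eq_finite_set (card_setT E)).
rewrite eqEsubset; split=> [_ [_ [x _ <-] <-]|x Ex].
  by have [_ ->] := gP x; exact: set_valP.
exists (g (SigSub (mem_set Ex))); first by exists (SigSub (mem_set Ex)).
by have [_ ->] := gP (SigSub (mem_set Ex)).
Qed.

Section SieveOfTree.
Variables (T : topologicalType) (N : nat -> Type) (V : forall n, N n -> set T).
Variables (root : set (N 0%N)) (child : forall n, N n -> set (N n.+1)).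
Arguments child {n}.
Hypothesis openV : forall n (a : N n), open (V a).
Hypothesis root_cover : \bigcup_(a in root) V a = [set: T].
Hypothesis child_cover : forall n (a : N n), V a = \bigcup_(b in child a) V b.

(* A sieve needs a unique parent for every index, so the indices at level [n]
   record the whole branch leading to a node. *)
Record level n := Level { branch : Type; tip : branch -> N n }.

Definition next_level n (l : level n) : level n.+1 :=
  @Level n.+1 [set p : branch l * N n.+1 | child (tip p.1) p.2]
    (fun p => (\val p).2).

Fixpoint tree_level n : level n :=
  if n is m.+1 then next_level (tree_level m)
  else @Level 0%N root (fun a => \val a).

Let idx n := branch (tree_level n).
Let pi n (b : idx n.+1) : idx n := (\val b).1.

Let refine n (a : idx n) :
  V (tip a) = \bigcup_(b in [set b : idx n.+1 | pi b = a]) V (tip b).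
Proof.
rewrite child_cover eqEsubset; split=> x [b].
  move=> ch Vb; have h : (a, b) \in [set p : idx n * N n.+1 | child (tip p.1) p.2].
    exact: mem_set.
  by exists (SigSub h : idx n.+1).
by move=> <- Vb; exists (tip b) => //; exact: set_valP b.
Qed.

Let cover n : \bigcup_(a in [set: idx n]) V (tip a) = [set: T].
Proof.
elim: n => [|n IH]; rewrite -subTset => x _.
  have := root_cover; rewrite -subTset => /(_ x I)[a ra Va].
  by exists (SigSub (mem_set ra) : idx 0).
move: IH; rewrite -subTset => /(_ x I)[a _].
by rewrite refine => -[b _ Vb]; exists b.
Qed.

Definition sieve_of_tree : sieve T :=
  @Sieve T idx (fun n a => V (tip a)) (@pi) (fun n a => @openV n (tip a)) cover refine.

(** Forgetting the recorded branches lets completeness be checked on nodes alone. *)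
Lemma pi_chain_sieve_of_tree (alpha : forall n, sv_idx sieve_of_tree n) :
  pi_chain alpha -> exists a : forall n, N n,
    [/\ root (a 0%N), forall n, child (a n) (a n.+1) &
        forall n, sv_U (alpha n) = V (a n)].
Proof.
move=> ch; exists (fun n => tip (alpha n)); split => //.
  exact: set_valP (alpha 0%N).
by move=> n; rewrite -(ch n); exact: set_valP (alpha n.+1).
Qed.

Lemma card_sieve_of_tree (K : pointedType) : infinite_set [set: K] ->
  root #<= [set: K] -> (forall n (a : N n), child a #<= [set: K]) ->
  forall n, [set: sv_idx sieve_of_tree n] #<= [set: K].
Proof.
move=> infK rootK childK; elim=> [|n IH].
  by rewrite (card_le_eql (card_setT _)).
rewrite (card_le_eql (card_setT _)).
apply: card_le_trans (card_setX_le infK IH (fun a _ => childK n (tip a))).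
by apply: subset_card_le => -[a b].
Qed.

End SieveOfTree.

(** * Complete sieves *)

Lemma pi_chain_decreasing (T : topologicalType) (S : sieve T)
    (alpha : forall n, sv_idx S n) :
  pi_chain alpha -> forall n, sv_U (alpha n.+1) `<=` sv_U (alpha n).
Proof.
by move=> ch n x Ux; rewrite sv_refine; exists (alpha n.+1) => //; exact: ch.
Qed.

Lemma complete_sieve_sequence (T : topologicalType) (S : sieve T)
    (alpha : forall n, sv_idx S n) :
  complete_sieve S -> pi_chain alpha ->
  complete_sequence (fun n => sv_U (alpha n)).
Proof.
move=> cS ch G GU GUn; have [||x clx] := cS alpha ch G.
- split; first by exists setT; exact: filterT.
  split=> [b /filter_ex//|b1 b2 G1 G2].
  by exists (b1 `&` b2) => //; exact: filterI.
- by move=> b n Gb; exact: proper_filter_meet _ Gb (GUn n).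
by exists x; rewrite -[_ --> _]/([set p | G --> p] x) -ultra_cvg_clusterE clusterE.
Qed.

(** At each level an ultrafilter containing the finite union contains one of its sets. The indices
    so selected are closed under [sv_pi], and Konig's lemma gives a chain of them. *)
Lemma complete_sieve_finite_unions (T : topologicalType) (S : sieve T)
    (E : forall n, set (sv_idx S n)) :
  complete_sieve S -> (forall n, finite_set (E n)) ->
  (forall n, @sv_pi T S n @` E n.+1 `<=` E n) ->
  complete_sequence (fun n => \bigcup_(a in E n) sv_U a).
Proof.
move=> cS finE piE G GU GE.
have [|||alpha [Galpha ch]] :=
    @konig _ (@sv_pi T S) (fun n => [set a | E n a /\ G (sv_U a)]).
- by move=> n; apply: sub_finite_set (finE n) => a [].
- by move=> n; have [a Ea Ga] := ultra_finite_bigcup GU (finE n) (GE n); exists a.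
- move=> n _ [b [Eb Gb] <-]; split; first by apply: piE; exists b.
  by apply: filterS Gb => x Ux; rewrite sv_refine; exists b.
by apply: (complete_sieve_sequence cS ch GU) => n; have [] := Galpha n.
Qed.

(** * Transfer of a sieve along a set tri-quotient map *)

Section TriQuotient.
Variables (R : realType) (X Y : topologicalType) (F : set X -> set Y).
Hypotheses (regX : regular_space X) (muY : mu_space R Y).
Hypotheses (cF : compact_valued F) (mF : monotone_on_compacta F).
Variable s : set X -> set Y.
Hypothesis s_open : forall U, open U -> open (s U).
Hypothesis s_image : forall U, open U ->
  s U `<=` \bigcup_(K in [set K | compact K /\ K `<=` U]) F K.
Hypothesis s_total : s [set: X] = [set: Y].
Hypothesis s_mono : forall U V, open U -> open V -> U `<=` V -> s U `<=` s V.
Hypothesis s_finite : forall U y, open U -> s U y ->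
  forall W : set (set X), (forall w, W w -> open w) ->
  \bigcup_(K in [set K | compact K /\ F K y /\ K `<=` U]) K
    `<=` \bigcup_(w in W) w ->
  exists2 E : set (set X), finite_set E /\ E `<=` W & s (\bigcup_(w in E) w) y.

(** (str4) for indexed families: a cover of [V] covers in particular the compact subsets of [V]. *)
Lemma tri_quotient_finite (I : Type) (U : I -> set X) (A : set I) (V : set X) y :
  (forall i, open (U i)) -> open V -> V `<=` \bigcup_(i in A) U i -> s V y ->
  exists2 B, B `<=` A & finite_set B /\ s (\bigcup_(i in B) U i) y.
Proof.
move=> openU openV VU sVy.
have [||E [finE EUA] sE] := @s_finite V y openV sVy (U @` A).
- by move=> _ [i _ <-].
- move=> x [K [_ [_ KV]] /KV/VU[i Ai Ux]].
  by exists (U i) => //; exists i.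
have [B BA [finB UB]] := finite_subset_preimage finE EUA.
exists B => //; split => //; apply: s_mono sE; first 1 last.
- by apply: bigcup_open => i _.
- by rewrite -UB bigcup_image.
- by rewrite -UB; apply: bigcup_open => _ [i _ <-].
Qed.

Variable S : sieve X.
Hypothesis cS : complete_sieve S.

Let U n (E : set (sv_idx S n)) := \bigcup_(a in E) sv_U a.

Let openU n (E : set (sv_idx S n)) : open (U E).
Proof. by apply: bigcup_open => a _; exact: sv_open. Qed.

Let subU n (E : set (sv_idx S n)) (E' : set (sv_idx S n.+1)) :
  @sv_pi X S n @` E' `<=` E -> U E' `<=` U E.
Proof.
move=> piE x [b E'b Ux]; exists (sv_pi b); first by apply: piE; exists b.
by rewrite sv_refine; exists b.
Qed.

(** A node is a finite set [E] of indices, standing for [s (U E)]; its children are the finite sets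
    of indices with parents in [E]. Completeness and size concern one and the same sieve, since the
    Lindelof bound uses both. *)
Lemma tri_quotient_sieve : exists2 S' : sieve Y, complete_sieve S' &
  forall K : pointedType, infinite_set [set: K] ->
  (forall n, [set: sv_idx S n] #<= [set: K]) ->
  forall n, [set: sv_idx S' n] #<= [set: K].
Proof.
pose root := [set E : set (sv_idx S 0) | finite_set E].
pose child n (E : set (sv_idx S n)) :=
  [set E' : set (sv_idx S n.+1) | finite_set E' /\ @sv_pi X S n @` E' `<=` E].
pose V n (E : set (sv_idx S n)) := s (U E).
have openV n (E : set (sv_idx S n)) : open (V n E) by exact: s_open.
have rootV : \bigcup_(E in root) V 0%N E = [set: Y].
  rewrite -subTset => y _.
  have [||||B _ [finB sB]] := @tri_quotient_finite _ (@sv_U X S 0) setT setT y.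
  - exact: sv_open.
  - exact: openT.
  - by rewrite sv_cover.
  - by rewrite s_total.
  by exists B.
have childV n (E : set (sv_idx S n)) :
    V n E = \bigcup_(E' in child n E) V n.+1 E'.
  rewrite eqEsubset; split=> [y sy|y [E' [_ piE] sy]]; last first.
    by apply: s_mono sy => //; exact: subU.
  (* The sets with parent in [E] cover [U E], so (str4) finds a child of [E] at [y]. *)
  have [|||B BA [finB sB]] := @tri_quotient_finite _ (@sv_U X S n.+1)
      [set b | E (sv_pi b)] (U E) y _ _ _ sy.
  - exact: sv_open.
  - exact: openU.
  - move=> x [a Ea]; rewrite sv_refine => -[b pib Ux]; exists b => //=.
    by rewrite pib.
  by exists B => //; split => // _ [b /BA Eb <-].
exists (sieve_of_tree openV rootV childV).
  move=> alpha /pi_chain_sieve_of_tree[E [E0 ch VE]] B fB meshB.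
  have finE n : finite_set (E n).
    by case: n => [|n]; [exact: E0|have [] := ch n].
  have piE n : @sv_pi X S n @` E n.+1 `<=` E n by have [] := ch n.
  apply: (mu_space_cluster (V := fun n => s (U (E n))) muY) => //.
  - by move=> n; apply: s_mono => //; exact: subU.
  (* (str1) puts each [y n] in some [F (K n)]; a common compact superset [L] of the [K n] then gives
     the compact set [F L]. *)
  - move=> y /= sy; have /choice[K KP] : forall n, exists K,
        [/\ compact K, K `<=` U (E n) & F K (y n)].
      by move=> n; have [K [cK KU] FK] := s_image (openU (E n)) (sy n); exists K.
    have [|||||L cL KL] := @common_compact X (fun n => U (E n)) K.
    + exact: regX.
    + by move=> n; exact: subU.
    + exact: complete_sieve_finite_unions.
    + by move=> n; have [] := KP n.
    + by move=> n; have [] := KP n.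
    exists (F L); first exact: cF.
    by move=> n; have [cK _ FK] := KP n; exact: mF FK.
  - by move=> b n Bb; have := meshB b n Bb; rewrite VE.
move=> K infK SK; apply: card_sieve_of_tree => // [|n E].
  apply: card_le_trans (card_finite_subsets infK (SK 0%N)).
  by apply: subset_card_le => E finE; split.
apply: card_le_trans (card_finite_subsets infK (SK n.+1)).
by apply: subset_card_le => E' [finE _]; split.
Qed.

End TriQuotient.

(** * Lindelof numbers and the size of sieves *)

(** If no set of a chain through [y] were finitely covered by [U], these sets minus finite unions
    from [U] would form a meshing filter base; its cluster point would lie in some [u] of [U], which
    misses a member of the base. So finite subfamilies, one per index, cover [Y]. *)
Lemma lindelof_le_complete_sieve (Y : topologicalType) (S : sieve Y)
    (K : pointedType) :
  infinite_set [set: K] -> complete_sieve S ->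
  (forall n, [set: sv_idx S n] #<= [set: K]) -> lindelof_le Y K.
Proof.
move=> infK cS SK U openU coverU.
have finK (E : set (set Y)) : finite_set E -> E #<= [set: K].
  move=> /finite_set_countable EN; apply: card_le_trans EN _.
  exact: (iffLR (infiniteP _) infK).
have /choice[E EP] : forall p : {n & sv_idx S n}, exists E : set (set Y),
    [/\ finite_set E, E `<=` U &
      forall E', finite_set E' -> E' `<=` U ->
        sv_U (projT2 p) `<=` \bigcup_(u in E') u ->
        sv_U (projT2 p) `<=` \bigcup_(u in E) u].
  move=> [n a]; have [[E [finE EU aE]]|nE] := pselect (exists E,
      [/\ finite_set E, E `<=` U & sv_U a `<=` \bigcup_(u in E) u]).
    by exists E; split.
  (* A default for indices whose set has no finite subcover; the last condition is then vacuous. *)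
  exists set0; split => // E' finE' E'U aE'.
  by case: nE; exists E'.
exists (\bigcup_n \bigcup_(a in [set: sv_idx S n]) E (existT _ n a)).
  split; first by move=> u [n _ [a _]]; have [_ + _] := EP (existT _ n a); exact.
  rewrite -subTset => y _.
  have [||alpha [alphay ch]] := @dependent_choice_chain (sv_idx S)
      (fun n a => sv_U a y) (fun n a b => sv_pi b = a).
  - by have := sv_cover S 0; rewrite -subTset => /(_ y I)[a _ ay]; exists a.
  - by move=> n a; rewrite sv_refine => -[b ba by_]; exists b.
  have decS := nonincr_subset (pi_chain_decreasing ch).
  suff [n [E' [finE' E'U aE']]] : exists n E', [/\ finite_set E', E' `<=` U &
      sv_U (alpha n) `<=` \bigcup_(u in E') u].
    have [_ _ /(_ _ finE' E'U aE')] := EP (existT _ n (alpha n)).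
    move=> /(_ y (alphay n))[u Eu uy]; exists u => //.
    by exists n => //; exists (alpha n).
  apply: contrapT => nE.
  pose B := [set b | exists n E', [/\ finite_set E', E' `<=` U &
      b = sv_U (alpha n) `\` \bigcup_(u in E') u]].
  have B0 b : B b -> b !=set0.
    move=> [n [E' [finE' E'U ->]]]; apply: contrapT => b0.
    apply: nE; exists n, E'; split => // x ax.
    by apply: contrapT => nx; apply: b0; exists x.
  have BB E' : finite_set E' -> E' `<=` U ->
      B (sv_U (alpha 0%N) `\` \bigcup_(u in E') u).
    by move=> finE' E'U; exists 0%N, E'.
  have [||x clx] := cS alpha ch B.
  - split; first by exists (sv_U (alpha 0%N) `\` \bigcup_(u in set0) u); exact: BB.
    split=> // _ _ [n1 [E1 [finE1 E1U ->]]] [n2 [E2 [finE2 E2U ->]]].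
    exists (sv_U (alpha (maxn n1 n2)) `\` \bigcup_(u in E1 `|` E2) u).
      exists (maxn n1 n2), (E1 `|` E2); split => //; last by move=> u [/E1U|/E2U].
      by rewrite finite_setU.
    move=> x [ax nx]; split; split.
    + by apply: decS ax; exact: leq_maxl.
    + by move=> [u Eu ux]; apply: nx; exists u => //; left.
    + by apply: decS ax; exact: leq_maxr.
    + by move=> [u Eu ux]; apply: nx; exists u => //; right.
  - move=> _ n [m [E' [finE' E'U ->]]].
    have [|x [ax nx]] := B0 (sv_U (alpha (maxn m n)) `\` \bigcup_(u in E') u).
      by exists (maxn m n), E'.
    exists x; split; last by apply: decS ax; exact: leq_maxr.
    by split => //; apply: decS ax; exact: leq_maxl.
  have [u Uu ux] : (\bigcup_(u in U) u) x by rewrite coverU.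
  have [||z [[_ nz] uz]] := clx (sv_U (alpha 0%N) `\` \bigcup_(v in [set u]) v) _ u.
  - by apply: BB => // v ->.
  - by apply: open_nbhs_nbhs; split => //; exact: openU.
  by apply: nz; exists u.
apply: (card_bigcup_le infK); first exact: (iffLR (infiniteP _) infK).
move=> n _; apply: (card_bigcup_le infK) => // a _.
by apply: finK; have [] := EP (existT _ n a).
Qed.

Lemma card_preimage_le (T U : Type) (K : pointedType) (g : T -> U) (A : set U) :
  injective g -> A #<= [set: K] -> g @^-1` A #<= [set: K].
Proof.
move=> ginj /pcard_leTP/injPex[f finj]; apply/pcard_leTP/injPex.
by exists (f \o g) => x y /set_mem Ax /set_mem Ay /finj; rewrite !inE => /(_ Ax Ay)/ginj.
Qed.

(** By regularity the open sets with closure in some [U i] cover [C], and with the complement of [C]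
    they cover [X]. The members of [W] in a small subcover are paired with one index each. *)
Lemma lindelof_shrink (X : topologicalType) (K : pointedType) (I : Type)
    (A : set I) (U : I -> set X) (C : set X) :
  regular_space X -> lindelof_le X K -> (forall i, open (U i)) ->
  closed C -> C `<=` \bigcup_(i in A) U i ->
  exists N : set (set X * I), [/\ N #<= [set: K],
    forall p, N p -> [/\ A p.2, open p.1 & closure p.1 `<=` U p.2] &
    C `<=` \bigcup_(p in N) p.1].
Proof.
move=> regX LX openU clC CU.
pose W := [set w : set X | open w /\ exists2 i, A i & closure w `<=` U i].
have [||Z [ZW Zcover] ZK] := LX (W `|` [set ~` C]).
- by move=> w [[]//|->]; exact: closed_openC.
- rewrite -subTset => x _; have [Cx|nCx] := pselect (C x); last first.
    by exists (~` C) => //; right.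
  have [i Ai Ux] := CU x Cx.
  have [M Mx clMU] := regX x _ (open_nbhs_nbhs (conj (openU i) Ux)).
  exists (M°) => //; left; split; first exact: open_interior.
  exists i => //; apply: subset_trans clMU.
  exact: closureS (@interior_subset _ M).
have /choice[f fP] : forall w : Z `&` W, exists i, A i /\ closure (\val w) `<=` U i.
  by move=> w; have [_ [_ [i Ai clU]]] := set_valP w; exists i.
exists (range (fun w : Z `&` W => (\val w, f w))); split.
- apply: card_le_trans (card_image_le _ _) _.
  rewrite (card_le_eql (card_setT _)); apply: card_le_trans ZK.
  exact: subset_card_le.
- move=> _ [w _ <-] /=; have [Aw clw] := fP w; split => //.
  by have [_ []] := set_valP w.
- move=> x Cx; have [w Zw wx] : (\bigcup_(w in Z) w) x by rewrite Zcover.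
  have [Ww|wC] := ZW w Zw; last by move: wx; rewrite wC.
  have h : w \in Z `&` W by exact: mem_set.
  by exists (w, f (SigSub h)) => //; exists (SigSub h).
Qed.

(* An open set need not be Lindelof, so each node of the thinned tree is an open
   set with closure inside a member of the given sieve, and the children of that
   member are shrunk so as to cover the closure. *)
Lemma lindelof_complete_sieve (X : topologicalType) (K : pointedType)
    (S : sieve X) :
  regular_space X -> infinite_set [set: K] -> lindelof_le X K ->
  complete_sieve S ->
  exists2 S' : sieve X, complete_sieve S' &
    forall n, [set: sv_idx S' n] #<= [set: K].
Proof.
move=> regX infK LX cS.
pose N n := {p : set X * sv_idx S n | open p.1 /\ closure p.1 `<=` sv_U p.2}.
pose V n (u : N n) := (sval u).1.
have svinj n : injective (fun u : N n => sval u).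
  by move=> [p hp] [q hq] /= pq; exact: eq_exist.
have [|||N0 [N0K N0P N0cover]] :=
    @lindelof_shrink X K _ setT (@sv_U X S 0) setT regX LX.
- exact: sv_open.
- exact: closedT.
- by rewrite sv_cover.
have exM n (u : N n) : exists M : set (set X * sv_idx S n.+1),
    [/\ M #<= [set: K],
      forall p, M p -> [/\ sv_pi p.2 = (sval u).2, open p.1 & closure p.1 `<=` sv_U p.2] &
      closure (V n u) `<=` \bigcup_(p in M) p.1].
  apply: (lindelof_shrink regX LX (A := [set b | sv_pi b = (sval u).2])).
  - exact: sv_open.
  - exact: closed_closure.
  - by move=> x /(proj2 (svalP u)); rewrite sv_refine.
pose M n (u : N n) := sval (cid (exM n u)).
have MP n (u : N n) := svalP (cid (exM n u)).
pose root := [set u : N 0 | N0 (sval u)].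
(* Intersecting with [V n u] makes the children cover exactly their parent and preserves the
   inclusion of closures. *)
pose child n (u : N n) := [set v : N n.+1 |
  ((fun p => (p.1 `&` V n u, p.2)) @` M n u) (sval v)].
have openV n (u : N n) : open (V n u) by have [] := svalP u.
have rootV : \bigcup_(u in root) V 0%N u = [set: X].
  rewrite -subTset => x /N0cover[p Np px].
  have [_ openp clp] := N0P p Np.
  by exists (exist _ p (conj openp clp)).
have childV n (u : N n) : V n u = \bigcup_(v in child n u) V n.+1 v.
  rewrite eqEsubset; split=> [x ux|x [v [p Mp pv]]]; last first.
    by rewrite /V -pv => -[].
  have [_ MP' /(_ x (subset_closure ux))[p Mp px]] := MP n u.
  have [_ openp clp] := MP' p Mp.
  have h : open (p.1 `&` V n u) /\ closure (p.1 `&` V n u) `<=` sv_U p.2.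
    split; first exact: openI.
    by apply: subset_trans clp; apply: closureS => ? [].
  by exists (exist _ (p.1 `&` V n u, p.2) h) => //; exists p.
exists (sieve_of_tree openV rootV childV).
  move=> alpha /pi_chain_sieve_of_tree[u [_ ch Vu]] B fB meshB.
  (* The second components form a chain of [S], whose sets contain the nodes and so mesh with [B] as
     well. *)
  apply: (cS (fun n => (sval (u n)).2)) fB _ => [n|b n Bb].
    by have [p Mp <-] := ch n; have [_ /(_ p Mp)[]] := MP n (u n).
  have [x [bx]] := meshB b n Bb; rewrite Vu => ux; exists x; split => //.
  by apply: (proj2 (svalP (u n))); exact: subset_closure.
apply: card_sieve_of_tree => // [|n u].
  exact: (card_preimage_le (svinj 0%N)).
apply: (card_preimage_le (svinj n.+1)).
by apply: card_le_trans (card_image_le _ _) _; have [] := MP n u.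
Qed.

Theorem theorem1p4 (R : realType) (X Y : topologicalType) (F : set X -> set Y) :
  tychonoff_space X -> tychonoff_space Y ->
  sieve_complete X -> mu_space R Y ->
  compact_valued F -> monotone_on_compacta F -> set_tri_quotient F ->
  sieve_complete Y /\ lindelof_number_le Y X.
Proof.
move=> [crX _] _ [S cS] muY cF mF [s [s1 [s2 [s3 [s4 s5]]]]].
have regX : regular_space X := completely_regular_regular (R := R) crX.
split.
  have [S' cS' _] := tri_quotient_sieve regX muY cF mF s1 s2 s3 s4 s5 cS.
  by exists S'.
(* The cardinal lemmas take a pointed [K]; an empty one is not infinite. *)
elim/Ppointed => K infK LX; first by case: infK; rewrite emptyE; exact: finite_set0.
have [T cT TK] := @lindelof_complete_sieve X K S regX infK LX cS.
have [S' cS' S'K] := tri_quotient_sieve regX muY cF mF s1 s2 s3 s4 s5 cT.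
exact: (@lindelof_le_complete_sieve Y S' K infK cS' (S'K K infK TK)).
Qed.
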